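(* The deterministic online algorithm PD-OMFLP for the Online Multi-Commodity Facility Location Problem has a competitive ratio of $O\left(\sqrt{|S|}\cdot\log n\right)$, where $S$ is the set of commodities and $n$ the number of requests.
   Context: Online Multi-Commodity Facility Location Problem (OMFLP). An instance consists of a finite metric space with point set $M$ and distance $d$, a finite set $S$ of commodities, construction costs $f_m^\sigma$ for all $m\in M$ and $\sigma\subseteq S$ (all known in advance), and a sequence of $n$ requests. Each request $r$ is located at a point of $M$ and demands a set $s_r\subseteq S$; $d(m,r)$ denotes the distance from $m\in M$ to the location of $r$. A solution opens facilities, each at a point $m\in M$ with a configuration $\sigma\subseteq S$ (the set of commodities it offers), at cost $f_m^\sigma$; several facilities may be opened at the same point. Each request $r$ is assigned to a set of open facilities that jointly offer all commodities of $s_r$, at assignment cost equal to the sum of the distances from $r$ to these facilities. The total cost is the sum of all construction and assignment costs. Requests are revealed one by one; on arrival a request must immediately be assigned, where the algorithm may first open new facilities; all decisions are irrevocable. Standing assumptions on the costs: (i) subadditivity: for every $m\in M$, every $\sigma\subseteq S$ and all $a,b\subseteq\sigma$ with $a\cup b=\sigma$, $f_m^\sigma\le f_m^a+f_m^b$; (ii) $f_m^\sigma/|\sigma|\ge f_m^S/|S|$ for all $m\in M$ and all nonempty $\sigma\subseteq S$. Competitive ratio: an online algorithm is $c$-competitive if there is a constant $a$, independent of the instance, such that on every instance its cost is at most $c\cdot\mathrm{OPT}+a$, where OPT is the optimal offline cost. Algorithm PD-OMFLP. A facility is small if its configuration is a singleton $\{e\}$ and large if its configuration is $S$. At any time, $F(e)$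 is the set of currently open facilities offering $e$, and $\hat F$ the set of currently open large facilities; $d(G,r)$ is the distance from $r$ to the closest facility of $G$ ($\infty$ if $G=\emptyset$); $(a)_+=\max\{a,0\}$. When a request $r$ arrives, let $R$ be the set of requests that arrived earlier (their values $a_{je}$, $e\in s_j$, are already fixed). Start with $a_{re}=0$ and all $e\in s_r$ unserved, and simultaneously increase all $a_{re}$ with $e\in s_r$ unserved, while respecting the constraints (1) $a_{re}\le d(F(e),r)$ for all $e\in s_r$; (2) $\sum_{e\in s_r}a_{re}\le d(\hat F,r)$; (3) $(a_{re}-d(m,r))_+ +\sum_{j\in R:\,e\in s_j}(\min\{a_{je},d(F(e),j)\}-d(m,j))_+\le f_m^{\{e\}}$ for all $e\in s_r$, $m\in M$; (4) $\left(\sum_{e\in s_r}a_{re}-d(m,r)\right)_+ +\sum_{j\in R}\left(\min\{\sum_{e\in s_j}a_{je},d(\hat F,j)\}-d(m,j)\right)_+\le f_m^S$ for all $m\in M$. If (1) or (3) becomes tight for an unserved $e$ (with $m$ the location of the closest facility in $F(e)$, resp. the point $m$ in (3)), freeze $a_{re}$ and declare $e$ served by $m$; in case (3) also declare a small facility with configuration $\{e\}$ at $m$ temporarily open. If (2) or (4) becomes tight (with $m$ the location of the closest large facility, resp. the point $m$ in (4)), freeze $a_{re'}$ for all $e'\in s_r$, declare all $e'\in s_r$ served by the large facility at $m$, and remove all temporarily open facilities; in case (4) open a large facility at $m$. The process ends when all $e\in s_r$ are served; then all remaining temporarily open facilities are opened and $r$ is assigned to the facilities serving its commodities.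
   Formalization: The formal theorem additionally assumes that a singleton configuration never costs more than a configuration containing it at the same point ($f_m^{\{e\}}\le f_m^\sigma$ for $e\in\sigma$); under (i) and (ii) alone the claimed ratio fails. *)

(* Defs.v *)
From HB Require Import structures.
From mathcomp Require Import all_boot all_order all_algebra.
From mathcomp Require Import all_classical all_reals all_analysis.
(* [set0], etc. denote finite sets; sets as predicates only occur in [opt] *)
From mathcomp Require Import finset.

Set Implicit Arguments.
Unset Strict Implicit.
Unset Printing Implicit Defensive.

Import Order.TTheory GRing.Theory Num.Theory.
Local Open Scope ring_scope.

(* [r.1] is the location of the request [r], [r.2] its demand. *)
Notation request M S := (M * {set S})%type (only parsing).

(* [x.1] is the location of the facility [x], [x.2] its configuration. *)
Notation facility M S := (M * {set S})%type (only parsing).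

(* Everything that is known in advance.
   Nonnegativity of the distances and of the costs is derivable: for the costs,
   take [a = b = sigma] in [cost_subadd].
   [cost_single] does not follow from the other two cost assumptions, and no
   algorithm that only builds small and large facilities is
   O(sqrt |S| * log n)-competitive without it.  On a one-point space, let
   cost sigma = |sigma| for |sigma| <> 1 and cost [set e] = 20 * |S|; for
   requests demanding two fixed commodities the optimum is 2, while such an
   algorithm pays at least |S|; rescaling the costs defeats any additive
   constant. *)
Record omflp (R : realType) (M S : finType) := Omflp {
  dist : M -> M -> R;
  cost : M -> {set S} -> R;
  dist_eq0 : forall x y, dist x y = 0 <-> x = y;
  dist_sym : forall x y, dist x y = dist y x;
  dist_triangle : forall x y z, dist x z <= dist x y + dist y z;
  cost_subadd : forall m (sigma a b : {set S}),
    a \subset sigma -> b \subset sigma -> a :|: b = sigma ->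
    cost m sigma <= cost m a + cost m b;
  cost_ratio : forall m (sigma : {set S}), sigma != set0 ->
    cost m [set: S] / #|S|%:R <= cost m sigma / #|sigma|%:R;
  cost_single : forall m (sigma : {set S}) e, e \in sigma ->
    cost m [set e] <= cost m sigma
}.

(* [opened] is a sequence because several facilities may be opened at the same
   point, each one being paid for.  A request is assigned to a set of pairs
   (location, configuration): distinct copies of the same pair offer the same
   commodities at the same distance.  The entries of [assigned] correspond to
   the requests in order of arrival. *)
Record solution (M S : finType) := Solution {
  opened : seq (facility M S);
  assigned : seq {set facility M S}
}.

Definition feasible (M S : finType) (rs : seq (request M S))
    (sol : solution M S) : Prop :=
  size (assigned sol) = size rs /\
  forall p, p \in zip rs (assigned sol) ->
    {subset p.2 <= opened sol} /\ p.1.2 \subset \bigcup_(x in p.2) x.2.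

Section Cost.
Variables (R : realType) (M S : finType) (E : omflp R M S).

Definition total_cost (rs : seq (request M S)) (sol : solution M S) : R :=
  \sum_(x <- opened sol) cost E x.1 x.2 +
  \sum_(p <- zip rs (assigned sol)) \sum_(x in p.2) dist E x.1 p.1.1.

Definition opt (rs : seq (request M S)) : R :=
  inf [set total_cost rs sol | sol in [set sol | feasible rs sol]]%classic.

End Cost.

(* A deterministic online algorithm maps each sequence of requests to the
   solution held once these requests have been served. *)
Definition online_algorithm (R : realType) : Type :=
  forall M S : finType, omflp R M S -> seq (request M S) -> solution M S.

(* After each arrival the solution is feasible, and it extends the previous
   one (irrevocability). *)
Definition valid_online (R : realType) (A : online_algorithm R) : Prop :=
  forall (M S : finType) (E : omflp R M S) (rs : seq (request M S)),
    feasible rs (A M S E rs) /\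
    forall r, prefix (opened (A M S E rs)) (opened (A M S E (rcons rs r))) /\
      exists X, assigned (A M S E (rcons rs r)) =
                rcons (assigned (A M S E rs)) X.

(* The ratio may depend on the number of commodities and of requests; the
   additive constant may not depend on the instance. *)
Definition competitive (R : realType) (A : online_algorithm R)
    (c : nat -> nat -> R) : Prop :=
  exists a : R, forall (M S : finType) (E : omflp R M S)
    (rs : seq (request M S)),
    total_cost E rs (A M S E rs) <= c #|S| (size rs) * opt E rs + a.

(* A request that has been served: [dual j e] is the final value of a_{je},
   which is 0 when e is not demanded. *)
Record served_request (R : realType) (M S : finType) := ServedRequest {
  req : request M S;
  dual : {ffun S -> R};
  facs : {set facility M S}
}.

Record pd_state (R : realType) (M S : finType) := PdState {
  pd_open : seq (facility M S);
  pd_past : seq (served_request R M S)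
}.

Definition pd_solution (R : realType) (M S : finType) (st : pd_state R M S) :
    solution M S :=
  Solution (pd_open st) [seq facs j | j <- pd_past st].

Section PdOmflp.
Variables (R : realType) (M S : finType) (E : omflp R M S).

Local Notation d := (dist E).
Local Notation f := (cost E).

(* +oo when [G] is empty *)
Definition dist_to (G : seq (facility M S)) (p : M) : \bar R :=
  \big[mine/+oo%E]_(x <- G) (d x.1 p)%:E.

Definition pos (x : R) : R := Num.max x 0.

Definition cap (x : R) (G : seq (facility M S)) (p : M) : R :=
  fine (mine x%:E (dist_to G p)).

Section Request.
(* [st] is the state upon arrival of the request [r].  Temporarily open
   facilities are not in [pd_open st]: they only offer commodities that are
   already served. *)
Variables (st : pd_state R M S) (r : request M S).

Definition Fe (e : S) : seq (facility M S) :=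
  [seq x : facility M S <- pd_open st | e \in x.2].

Definition Fhat : seq (facility M S) :=
  [seq x : facility M S <- pd_open st | x.2 == [set: S]].

Definition con1 (e : S) (a : {ffun S -> R}) : Prop :=
  ((a e)%:E <= dist_to (Fe e) r.1)%E.

Definition con2 (a : {ffun S -> R}) : Prop :=
  ((\sum_(e in r.2) a e)%:E <= dist_to Fhat r.1)%E.

Definition con3 (e : S) (m : M) (a : {ffun S -> R}) : Prop :=
  pos (a e - d m r.1) +
  \sum_(j <- pd_past st | e \in (req j).2)
     pos (cap (dual j e) (Fe e) (req j).1 - d m (req j).1)
  <= f m [set e].

Definition con4 (m : M) (a : {ffun S -> R}) : Prop :=
  pos (\sum_(e in r.2) a e - d m r.1) +
  \sum_(j <- pd_past st)
     pos (cap (\sum_(e in (req j).2) dual j e) Fhat (req j).1 - d m (req j).1)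
  <= f m [set: S].

Definition constraints (a : {ffun S -> R}) : Prop :=
  [/\ forall e, e \in r.2 -> con1 e a, con2 a,
      forall e m, e \in r.2 -> con3 e m a & forall m, con4 m a].

Definition raise (U : {set S}) (t : R) (a : {ffun S -> R}) : {ffun S -> R} :=
  [ffun e => if e \in U then a e + t else a e].

(* A constraint is tight when it stops the increase of the unserved
   commodities [U].  Mere equality is too weak for the constraints of type (3)
   and (4): equality may hold while a_{re} (resp. the sum) is still below
   d(m, r), in which case raising the values does not violate the constraint. *)
Definition tight (U : {set S}) (P : {ffun S -> R} -> Prop)
    (a : {ffun S -> R}) : Prop :=
  P a /\ forall t, 0 < t -> ~ P (raise U t a).

(* [pd_process a U tmp X a' new X']: from the values [a], with unserved
   commodities [U], temporarily open facilities [tmp] and serving facilities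
   [X], the process may end with the values [a'], the facilities [new] being
   opened and [r] being assigned to [X'].  When several constraints are tight,
   or several facilities are closest, any of them may be selected. *)
Inductive pd_process : {ffun S -> R} -> {set S} -> seq (facility M S) ->
    {set facility M S} ->
    {ffun S -> R} -> seq (facility M S) -> {set facility M S} -> Prop :=
| PdDone a tmp X : pd_process a set0 tmp X a tmp X
| PdRaise a U tmp X a' new X' t :
    0 <= t -> constraints (raise U t a) ->
    pd_process (raise U t a) U tmp X a' new X' ->
    pd_process a U tmp X a' new X'
| PdTight1 a (U : {set S}) tmp X a' new X' e x :
    e \in U -> tight U (con1 e) a ->
    x \in Fe e -> (d x.1 r.1)%:E = dist_to (Fe e) r.1 ->
    pd_process a (U :\ e) tmp (x |: X) a' new X' ->
    pd_process a U tmp X a' new X'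
| PdTight3 a (U : {set S}) tmp X a' new X' e m :
    e \in U -> tight U (con3 e m) a ->
    pd_process a (U :\ e) (rcons tmp (m, [set e])) ((m, [set e]) |: X)
      a' new X' ->
    pd_process a U tmp X a' new X'
| PdTight2 a U tmp X x :
    tight U con2 a ->
    x \in Fhat -> (d x.1 r.1)%:E = dist_to Fhat r.1 ->
    pd_process a U tmp X a [::] [set x]
| PdTight4 a U tmp X m :
    tight U (con4 m) a ->
    pd_process a U tmp X a [:: (m, [set: S])] [set (m, [set: S])].

Definition pd_serve (st' : pd_state R M S) : Prop :=
  exists (a : {ffun S -> R}) (new : seq (facility M S))
         (X : {set facility M S}),
    pd_process [ffun=> 0] r.2 [::] set0 a new X /\
    st' = PdState (pd_open st ++ new)
                  (rcons (pd_past st) (ServedRequest r a X)).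

End Request.
End PdOmflp.

(* [A] is PD-OMFLP, for some way of resolving ties. *)
Definition is_PD_OMFLP (R : realType) (A : online_algorithm R) : Prop :=
  forall (M S : finType) (E : omflp R M S),
  exists run : seq (request M S) -> pd_state R M S,
    [/\ run [::] = PdState [::] [::],
        forall rs r, pd_serve E (run rs) r (run (rcons rs r)) &
        forall rs, A M S E rs = pd_solution (run rs)].

(* Main.v *)
(* The values a_{re} act as a dual solution.  Every facility that is opened and
   every assignment is paid for by values that are then spent, so the algorithm
   costs at most three times the sum of all values.  Conversely, fix a point m,
   a small (or the large) configuration of cost f at m, and any set of requests
   with values w and distances d to m.  By the triangle inequality, the
   constraint that held on the arrival of a request bounds
   sum_j (min (w_j, w_l - d_l - d_j) - d_j)_+ by f, where j ranges over the
   earlier requests of the set.  Once the requests with w < 2 d are discarded,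
   the smallest of k values is thus at most (2 f + 4 sum d) / k, and removing
   the smallest value repeatedly yields a bound O(log n) (f + sum d) on the sum
   of all values.  A configuration sigma of any solution is compared with its
   |sigma| singletons if |sigma| <= sqrt |S|, and with S otherwise; either way a
   factor sqrt |S| is lost. *)
Require Import Defs.
From mathcomp Require Import all_boot all_order all_algebra.
From mathcomp Require Import all_classical all_reals all_analysis.
From mathcomp Require Import fintype finset lra.
Import Order.TTheory GRing.Theory Num.Theory.
Local Open Scope ring_scope.

Set Implicit Arguments.
Unset Strict Implicit.
Unset Printing Implicit Defensive.

(** * Lists, finite sums and positive parts *)

Lemma zip_map2 (A B C : Type) (g : A -> B) (h : A -> C) (s : seq A) :
  zip (map g s) (map h s) = [seq (g x, h x) | x <- s].
Proof. by elim: s => //= x s ->. Qed.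

Lemma zip_mapl (A B C : Type) (h : A -> C) (s : seq A) (t : seq B) :
  zip (map h s) t = [seq (h q.1, q.2) | q <- zip s t].
Proof. by elim: s t => [|x s IH] [|y t] //=; rewrite IH. Qed.

Section Sums.
Variable R : realType.

Lemma pos_ge0 (x : R) : 0 <= pos x.
Proof. by rewrite /pos le_max lexx orbT. Qed.

Lemma le_pos (x : R) : x <= pos x.
Proof. by rewrite /pos le_max lexx. Qed.

Lemma pos_le (x y : R) : (pos x <= y) = (x <= y) && (0 <= y).
Proof. by rewrite /pos ge_max. Qed.

Lemma ler_pos (x y : R) : x <= y -> pos x <= pos y.
Proof. by move=> xy; rewrite pos_le pos_ge0 (le_trans xy (le_pos y)). Qed.

(** The side condition is carried by [all] rather than by membership, so that the lemma covers
    served requests, which are not given a decidable equality. *)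
Lemma ler_sum_all (T : Type) (P : pred T) (s : seq T) (F G : T -> R) :
  all P s -> (forall x, P x -> F x <= G x) ->
  \sum_(x <- s) F x <= \sum_(x <- s) G x.
Proof.
move=> /all_filterP <- FG; rewrite !big_filter.
by apply: ler_sum.
Qed.

Lemma sum_rcons_cond (T : Type) (P : pred T) (F : T -> R) s x :
  \sum_(y <- rcons s x | P y) F y =
  \sum_(y <- s | P y) F y + (if P x then F x else 0).
Proof.
by rewrite -cats1 big_cat /= big_cons big_nil; case: ifP; rewrite ?addr0.
Qed.

Lemma sum_mask_le (T : Type) (F : T -> R) (b : bitseq) (s : seq T) :
  (forall x, 0 <= F x) -> \sum_(x <- mask b s) F x <= \sum_(x <- s) F x.
Proof.
move=> F0; elim: s b => [|y s IH] [|[] b] //=.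
- by rewrite big_nil; apply: sumr_ge0.
- by rewrite !big_cons lerD2l.
- by rewrite big_cons (le_trans (IH b)) // lerDr.
Qed.

(** Repetitions in [s] count once on the left: copies of a facility are paid separately but need to
    be charged only once. *)
Lemma sum_mem_le (T : finType) (F : T -> R) (s : seq T) :
  (forall x, 0 <= F x) -> \sum_(x in s) F x <= \sum_(x <- s) F x.
Proof.
move=> F0; have -> : \sum_(x in s) F x = \sum_(x <- undup s) F x.
  rewrite big_uniq ?undup_uniq //.
  by apply: eq_bigl => x; rewrite mem_undup.
elim: s => //= x s IH; rewrite big_cons.
case: ifP => _; last by rewrite big_cons lerD2l.
by rewrite (le_trans IH) // lerDr.
Qed.

(** * Harmonic numbers and the logarithm *)

Lemma series_harmonic_ge1 (n : nat) : 1 <= series (@harmonic R) n.+1.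
Proof.
rewrite /series /= big_nat_recl // invr1 lerDl.
by apply: sumr_ge0 => i _; rewrite invr_ge0.
Qed.

Lemma series_harmonic_ge0 (n : nat) : 0 <= series (@harmonic R) n.
Proof. by rewrite /series /=; apply: sumr_ge0 => i _; rewrite invr_ge0. Qed.

Lemma series_harmonic_le (m n : nat) :
  (m <= n)%N -> series (@harmonic R) m <= series (@harmonic R) n.
Proof.
move=> mn; rewrite /series /= (@big_cat_nat _ _ _ m 0 n) //= lerDl.
by apply: sumr_ge0 => i _; rewrite invr_ge0.
Qed.

(** The increment [n.+2%:R^-1] is at most [ln n.+2%:R - ln n.+1%:R]: apply [ln (1 + x) <= x] at
    [x = - n.+2%:R^-1]. *)
Lemma series_harmonic_le_ln (n : nat) :
  series (@harmonic R) n.+1 <= 1 + ln n.+1%:R.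
Proof.
elim: n => [|n IH]; first by rewrite /series /= big_nat1 invr1 ln1 addr0.
have -> : series (@harmonic R) n.+2 = series (@harmonic R) n.+1 + n.+2%:R^-1.
  by rewrite /series /= big_nat_recr.
suff h : n.+2%:R^-1 <= ln (n.+2%:R : R) - ln n.+1%:R.
  rewrite (le_trans (lerD IH h)) // -[leLHS]addrA lerD2l; lra.
have n1 : (0 : R) < n.+1%:R by rewrite ltr0n.
have n2 : (0 : R) < n.+2%:R by rewrite ltr0n.
have gt1 : -1 < - n.+2%:R^-1 :> R.
  by rewrite ltrN2 invf_lt1 // ltr1n.
have := le_ln1Dx gt1.
have -> : 1 - n.+2%:R^-1 = n.+1%:R / n.+2%:R :> R.
  by rewrite -[in n.+1%:R](addrK 1 n.+1%:R) -natr1 mulrBl divff ?gt_eqF ?mul1r.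
rewrite ln_div ?posrE //.
by rewrite lerNr opprB.
Qed.

(** From [n = 2] on, the additive constant 1 is at most [ln n%:R / ln 2]. *)
Lemma series_harmonic_O (n : nat) : (2 <= n)%N ->
  series (@harmonic R) n <= (1 + (ln 2)^-1) * ln n%:R.
Proof.
case: n => // n n2; apply: le_trans (series_harmonic_le_ln n) _.
have l2 : (0 : R) < ln 2 by rewrite ln_gt0 // ltr1n.
rewrite mulrDl mul1r addrC lerD2l mulrC ler_pdivlMr // mul1r.
by rewrite ler_ln ?posrE ?ltr0n // ler_nat.
Qed.

End Sums.

(** * Consequences of a constraint that admits no further increase *)

Section Tightness.
Variable R : realType.

Lemma forall_gt0_lt (x y k : R) : 0 <= k ->
  (forall t, 0 < t -> ~ x + k * t <= y) -> y <= x.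
Proof.
move=> k0 H; rewrite leNgt; apply/negP => xy.
have k1 : 0 < k + 1 by rewrite ltr_wpDl.
(* Dividing by [k + 1] keeps the witness meaningful for [k = 0], and [k / (k + 1) <= 1] keeps the
   increase within [y - x]. *)
apply: (H ((y - x) / (k + 1))); first by rewrite divr_gt0 // subr_gt0.
rewrite mulrA -lerBrDl ler_pdivrMr // mulrC ler_pM2l ?subr_gt0 //.
by rewrite lerDl.
Qed.

(* A stopping constraint is an equality in which the positive part is not
   truncated. *)
Lemma forall_gt0_pos (x k s f : R) : 0 <= k -> pos x + s <= f ->
  (forall t, 0 < t -> ~ pos (x + k * t) + s <= f) ->
  0 <= x /\ f <= x + s.
Proof.
move=> k0 Pxs H.
have fx : f - s <= x.
  apply: (forall_gt0_lt k0) => t t0 le; apply: (H t t0).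
  rewrite -lerBrDr pos_le le /=.
  by rewrite (le_trans (pos_ge0 x)) // lerBrDr.
split; last by rewrite -lerBlDr.
by apply: le_trans fx; rewrite subr_ge0 (le_trans _ Pxs) // lerDr pos_ge0.
Qed.

End Tightness.

(** * Histories of values *)

Section History.
Variables (R : realType).

Definition history_head (T : Type) (w d : T -> R) (f : R) (x : T) (s : seq T) :=
  pos (w x - d x) +
  \sum_(y <- s) pos (Num.min (w y) (w x - d x - d y) - d y) <= f.

(* What a constraint of type (3) or (4) says about the requests [x :: s],
   listed from the last to arrive to the first, when their values are [w], their
   distances to the point are [d] and the cost is [f]: the open facilities are
   eliminated by the triangle inequality. *)
Fixpoint history (T : Type) (w d : T -> R) (f : R) (s : seq T) : Prop :=
  if s is x :: s' then history_head w d f x s' /\ history w d f s' else True.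

Lemma history_map (T T' : Type) (g : T -> T') (w d : T' -> R) f (s : seq T) :
  history w d f (map g s) = history (w \o g) (d \o g) f s.
Proof.
by elim: s => //= x s ->; rewrite /history_head big_map.
Qed.

(** Deleting a request removes its own inequality and a nonnegative summand from those of later
    requests. *)
Lemma history_mask (T : Type) (w d : T -> R) f (b : bitseq) (s : seq T) :
  history w d f s -> history w d f (mask b s).
Proof.
elim: s b => [|x s IH] [|[] b] //= [hd tl]; last exact: IH.
split; last exact: IH.
apply: le_trans hd; rewrite lerD2l; apply: sum_mask_le => y.
exact: pos_ge0.
Qed.

Lemma history_filter (T : Type) (w d : T -> R) f (P : pred T) (s : seq T) :
  history w d f s -> history w d f [seq x <- s | P x].
Proof. by rewrite filter_mask; apply: history_mask. Qed.

(** Only the inequality of the last request [x] is used. Since [2 * d x <= w x], its first term is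
    at least [v / 2], and the term of any other [y] is at least [v / 2 - 2 * d y], whichever side of
    the minimum is attained. Summing and doubling gives the bound. *)
Lemma history_min_le (T : Type) (w d : T -> R) f (v D : R) (s : seq T) :
  (forall x, 0 <= d x) ->
  history w d f s -> all (fun x => (2 * d x <= w x) && (v <= w x)) s ->
  \sum_(x <- s) d x <= D -> 0 <= f -> v * (size s)%:R <= 2 * f + 4 * D.
Proof.
move=> d0; case: s => [|x s] /=.
  by rewrite mulr0 big_nil => _ _ D0 f0; lra.
case=> hd _ /andP[/andP[dx vx] /all_filterP als].
rewrite big_cons => sD f0.
have : \sum_(y <- s) (v / 2 - 2 * d y) <= 
  \sum_(y <- s) pos (Num.min (w y) (w x - d x - d y) - d y).
  rewrite -als !big_filter; apply: ler_sum => y /andP[dy vy].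
  apply: le_trans (le_pos _).
  rewrite lerBrDr le_min; have := d0 x; have := d0 y; lra.
have -> : \sum_(y <- s) (v / 2 - 2 * d y) =
    v / 2 * (size s)%:R - 2 * \sum_(y <- s) d y.
  rewrite sumrB mulr_sumr; congr (_ - _).
  by rewrite big_const_seq count_predT iter_addr_0 mulr_natr.
move: hd; rewrite /history_head -[(size s).+1%:R]natr1 => hd sle.
have sd0 : 0 <= \sum_(y <- s) d y by apply: sumr_ge0.
have := le_pos (w x - d x); have := d0 x; lra.
Qed.

End History.

Section HistorySum.
Variables (R : realType).

(** Induction on the number [k] of requests: the smallest value is at most [(2 * f + 4 * D) / k] and
    is removed. As [D] is only an upper bound on the distances, it stays fixed while the list
    shrinks. *)
Lemma history_sum_close (T : eqType) (w d : T -> R) (f D : R) (s : seq T) :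
  (forall x, 0 <= d x) -> 0 <= f ->
  history w d f s -> all (fun x => 2 * d x <= w x) s ->
  \sum_(x <- s) d x <= D ->
  \sum_(x <- s) w x <= series harmonic (size s) * (2 * f + 4 * D).
Proof.
move=> d0 f0; move: {2}(size s) (erefl (size s)) => n.
elim: n s => [|n IH] s sn.
  by move=> *; rewrite sn (size0nil sn) big_nil /series /= big_geq // mul0r.
move=> hs als sD.
have [x xs xmin] : exists2 x, x \in s & all (fun y => w x <= w y) s.
  case: s sn {als sD hs} => // y s _.
  elim: s y => [|z s IHs] y; first by exists y; rewrite ?mem_head //= lexx.
  have [x xs xmin] := IHs z; have [yx|xy] := leP (w y) (w x).
    exists y; rewrite ?mem_head // /= lexx /=.
    by apply: sub_all xmin => u /=; apply: le_trans.
  exists x; first by rewrite in_cons xs orbT.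
  by rewrite /= (ltW xy).
have rs : subseq (rem x s) s := rem_subseq x s.
have srs : size (rem x s) = n by rewrite size_rem // sn.
have rle : \sum_(y <- rem x s) w y <= series harmonic n * (2 * f + 4 * D).
  rewrite -[in series _ n]srs; apply: IH => //.
  - by have /subseqP[b _ ->] := rs; apply: history_mask.
  - by apply/allP => y /(mem_subseq rs); move/allP: als; apply.
  - by apply: le_trans sD; rewrite (big_rem _ xs) /= lerDr.
rewrite (big_rem _ xs) /= sn.
have -> : series harmonic n.+1 = series harmonic n + n.+1%:R^-1 :> R.
  by rewrite /series /= big_nat_recr.
rewrite mulrDl addrC lerD //.
rewrite mulrC ler_pdivlMr ?ltr0n // -sn.
apply: (history_min_le d0 hs _ sD f0).
by rewrite all_predI als xmin.
Qed.

(** The requests with [w x < 2 * d x] contribute at most twice the sum of the distances. The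
    harmonic number of a nonempty list is at least 1 and absorbs this, which turns the 4 of the
    close requests into 6. *)
Lemma history_sum (T : Type) (w d : T -> R) (f : R) (s : seq T) :
  (forall x, 0 <= d x) -> 0 <= f -> history w d f s ->
  \sum_(x <- s) w x <=
    series harmonic (size s) * (2 * f + 6 * \sum_(x <- s) d x).
Proof.
move=> d0 f0 hs; set P := fun x => 2 * d x <= w x.
set D := \sum_(x <- s) d x; set H := series _ _.
have D0 : 0 <= D by apply: sumr_ge0.
have [s0|s0] := posnP (size s).
  by rewrite /H s0 (size0nil s0) big_nil /series /= big_geq // mul0r.
have H1 : 1 <= H by rewrite /H -(prednK s0) series_harmonic_ge1.
have close : \sum_(x <- s | P x) w x <= H * (2 * f + 4 * D).
  rewrite -big_filter; set t := [seq x <- s | P x].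
  have tD : \sum_(x <- t) d x <= D by rewrite /t filter_mask sum_mask_le.
  have ht : history w d f t by apply: history_filter.
  have als : all P t by apply: filter_all.
  (* Removing an element from a list requires an equality test, which [{classic T}] supplies for any
     type. *)
  have /le_trans := @history_sum_close {classic T} w d f D t d0 f0 ht als tD.
  apply.
  rewrite ler_wpM2r ?series_harmonic_le ?addr_ge0 ?mulr_ge0 //.
  by rewrite size_filter count_size.
have far : \sum_(x <- s | ~~ P x) w x <= 2 * D.
  rewrite mulr_sumr big_mkcond /=; apply: ler_sum => x _.
  case: ifP => [|_]; last by rewrite mulr_ge0.
  by rewrite -ltNge => /ltW.
rewrite (bigID P) /=; apply: le_trans (lerD close far) _.
have : 2 * D <= H * (2 * D) by rewrite ler_peMl // mulr_ge0.
lra.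
Qed.

End HistorySum.
(** * One execution of the process *)

Section Instance.
Variables (R : realType) (M S : finType) (E : omflp R M S).

Local Notation d := (dist E).
Local Notation f := (cost E).

Lemma dist_ge0 x y : 0 <= d x y.
Proof.
have xx : d x x = 0 by apply/dist_eq0.
by have := dist_triangle E x y x; rewrite xx (dist_sym E y x); lra.
Qed.

Lemma cost_ge0 m (sigma : {set S}) : 0 <= f m sigma.
Proof.
have := cost_subadd E m (subxx sigma) (subxx sigma) (setUid sigma).
lra.
Qed.

Lemma le_dist_to (y : R) (G : seq (facility M S)) p :
  (y%:E <= dist_to E G p)%E = all (fun g => y <= d g.1 p) G.
Proof.
rewrite /dist_to; elim: G => [|g G IH]; first by rewrite big_nil leey.
by rewrite big_cons le_min lee_fin IH.
Qed.

(** Nothing is lost by [fine]: the minimum is at most [x] and, distances being nonnegative, it is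
    not [-oo]. *)
Lemma le_cap (y x : R) (G : seq (facility M S)) p :
  (y <= cap E x G p) = (y <= x) && all (fun g => y <= d g.1 p) G.
Proof.
rewrite -le_dist_to -(lee_fin y x) -le_min /cap -lee_fin fineK //.
rewrite fin_numElt; apply/andP; split; last by rewrite gt_min ltry.
rewrite lt_min ltNyr /=; apply: lt_le_trans (ltNyr 0) _.
by rewrite le_dist_to; apply/allP => g _; apply: dist_ge0.
Qed.

Lemma cap_le (x : R) (G : seq (facility M S)) p : cap E x G p <= x.
Proof. by have := le_cap (cap E x G p) x G p; rewrite lexx => /esym/andP[]. Qed.

Lemma cap_le_dist (x : R) (G : seq (facility M S)) p (g : facility M S) :
  g \in G -> cap E x G p <= d g.1 p.
Proof.
have := le_cap (cap E x G p) x G p; rewrite lexx => /esym/andP[_ /allP].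
exact.
Qed.

Lemma cap_ge0 (x : R) (G : seq (facility M S)) p : 0 <= x -> 0 <= cap E x G p.
Proof.
by move=> x0; rewrite le_cap x0; apply/allP => g _; apply: dist_ge0.
Qed.

Lemma cap_subset (x : R) (G G' : seq (facility M S)) p :
  {subset G <= G'} -> cap E x G' p <= cap E x G p.
Proof.
move=> GG'; rewrite le_cap cap_le /=; apply/allP => g /GG'.
exact: cap_le_dist.
Qed.

Lemma raise_in (U : {set S}) (t : R) a e :
  e \in U -> raise U t a e = a e + t.
Proof. by move=> eU; rewrite ffunE eU. Qed.

Lemma raise_notin (U : {set S}) (t : R) a e :
  e \notin U -> raise U t a e = a e.
Proof. by move=> /negbTE eU; rewrite ffunE eU. Qed.

Lemma raise_raise (U : {set S}) (t u : R) a :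
  raise U u (raise U t a) = raise U (t + u) a.
Proof.
by apply/ffunP => e; rewrite !ffunE; case: (e \in U); rewrite ?addrA.
Qed.

Lemma raise0 (U : {set S}) (a : {ffun S -> R}) : raise U 0 a = a.
Proof. by apply/ffunP => e; rewrite ffunE addr0 if_same. Qed.

Lemma sum_raise (U D : {set S}) (t : R) a : U \subset D ->
  \sum_(e in D) raise U t a e = \sum_(e in D) a e + #|U|%:R * t.
Proof.
move=> UD; under eq_bigr => e _.
  rewrite (_ : raise U t a e = a e + (if e \in U then t else 0)).
    over.
  by rewrite ffunE; case: ifP; rewrite // addr0.
rewrite big_split /= -big_mkcondr /=; congr (_ + _).
rewrite (eq_bigl (mem U)); last first.
  by move=> e; rewrite andbC; case eU : (e \in U) => //=; rewrite (subsetP UD).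
by rewrite sumr_const mulr_natl.
Qed.

(** * What the values pay for while one request is processed *)

Section Request.
Variables (st : pd_state R M S) (r : request M S).

Definition small_bids (e : S) (m : M) : R :=
  \sum_(j <- pd_past st | e \in (req j).2)
     pos (cap E (dual j e) (Fe st e) (req j).1 - d m (req j).1).

Definition large_bids (m : M) : R :=
  \sum_(j <- pd_past st)
     pos (cap E (\sum_(e in (req j).2) dual j e) (Fhat st) (req j).1
          - d m (req j).1).

Lemma tight_con1 (U : {set S}) a e (x : facility M S) :
  e \in U -> tight U (con1 E st r e) a ->
  (d x.1 r.1)%:E = dist_to E (Fe st e) r.1 -> d x.1 r.1 <= a e.
Proof.
move=> eU [_ H] dx; apply: (@forall_gt0_lt _ _ _ 1) => // t t0 le.
by apply: (H t t0); rewrite /con1 raise_in // -dx lee_fin -[t]mul1r.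
Qed.

Lemma tight_con2 (U : {set S}) a (x : facility M S) :
  U \subset r.2 -> tight U (con2 E st r) a ->
  (d x.1 r.1)%:E = dist_to E (Fhat st) r.1 ->
  d x.1 r.1 <= \sum_(e in r.2) a e.
Proof.
move=> Ur [_ H] dx; apply: (@forall_gt0_lt _ _ _ #|U|%:R) => // t t0 le.
by apply: (H t t0); rewrite /con2 sum_raise // -dx lee_fin.
Qed.

(** Tightness makes [a e] split into the distance to [m] and a nonnegative bid that completes the
    earlier bids to the cost of the facility. *)
Lemma tight_con3 (U : {set S}) a e m :
  e \in U -> tight U (con3 E st r e m) a ->
  d m r.1 <= a e /\ f m [set e] <= a e - d m r.1 + small_bids e m.
Proof.
move=> eU [P H]; rewrite -subr_ge0.
apply: (@forall_gt0_pos _ _ 1 _ _ _ P) => // t t0 le; apply: (H t t0).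
by rewrite /con3 raise_in // addrAC -[t]mul1r.
Qed.

Lemma tight_con4 (U : {set S}) a m :
  U \subset r.2 -> tight U (con4 E st r m) a ->
  d m r.1 <= \sum_(e in r.2) a e /\
  f m [set: S] <= \sum_(e in r.2) a e - d m r.1 + large_bids m.
Proof.
move=> Ur [P H]; rewrite -subr_ge0.
apply: (@forall_gt0_pos _ _ #|U|%:R _ _ _ P) => // t t0 le; apply: (H t t0).
by rewrite /con4 sum_raise // addrAC.
Qed.

(* The assignment [X] pays for its distances with the values of the served
   commodities. *)
Record partial_service (a : {ffun S -> R}) (U : {set S})
    (tmp : seq (facility M S)) (X : {set facility M S}) : Prop := {
  ps_unserved : U \subset r.2;
  ps_constraints : constraints E st r a;
  ps_ge0 : forall e, 0 <= a e;
  ps_open : {subset X <= pd_open st ++ tmp};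
  ps_cover : r.2 :\: U \subset \bigcup_(x in X) x.2;
  ps_dist : \sum_(x in X) d x.1 r.1 <= \sum_(e in r.2 :\: U) a e
}.

(** The commodities in [s] are distinct, so no value finances two small facilities; they are already
    served, so later raises leave their values unchanged. *)
Definition small_openings (a : {ffun S -> R}) (U : {set S})
    (tmp : seq (facility M S)) : Prop :=
  exists s : seq (S * M),
    [/\ tmp = [seq (p.2, [set p.1]) | p <- s], uniq (unzip1 s) &
     forall p, p \in s -> [/\ p.1 \in r.2 :\: U, d p.2 r.1 <= a p.1 &
       f p.2 [set p.1] <= a p.1 - d p.2 r.1 + small_bids p.1 p.2]].

Definition large_opening (a : {ffun S -> R})
    (new : seq (facility M S)) : Prop :=
  exists m, [/\ new = [:: (m, [set: S])], d m r.1 <= \sum_(e in r.2) a e &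
    f m [set: S] <= \sum_(e in r.2) a e - d m r.1 + large_bids m].

(** The value of [e], not charged so far, pays for the connection to [x]. *)
Lemma partial_service_setD1 (a : {ffun S -> R}) (U : {set S}) tmp X e
    (x : facility M S) :
  e \in U -> e \in x.2 -> d x.1 r.1 <= a e -> x \in pd_open st ++ tmp ->
  partial_service a U tmp X -> partial_service a (U :\ e) tmp (x |: X).
Proof.
move=> eU ex dx xo [Ur ca a0 oX cX dX].
have er : e \in r.2 by apply: subsetP eU.
have DU : r.2 :\: (U :\ e) = e |: (r.2 :\: U).
  by apply/setP => e'; rewrite !inE; case: (eqVneq e' e) => [->|_]; rewrite ?er.
split => //.
- exact: subset_trans (subsetDl _ _) Ur.
- by move=> y; rewrite !inE => /predU1P[->|/oX].
- rewrite DU subUset; apply/andP; split.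
    by rewrite sub1set; apply/bigcupP; exists x; rewrite ?setU11.
  apply: subset_trans cX _; apply/subsetP => e' /bigcupP[y yX e'y].
  by apply/bigcupP; exists y; rewrite // setU1r.
rewrite DU [leRHS]big_setU1 ?inE ?eU //=.
(* If [x] already serves the request, its distance is not counted again and the value of [e] is
   slack. *)
apply: le_trans _ (lerD dx dX); have [xX|xX] := boolP (x \in X).
  by rewrite (setUidPr _) ?sub1set // lerDr dist_ge0.
by rewrite big_setU1.
Qed.

(** Induction on the process. A raise moves unserved values only, so all charges to served
    commodities persist. When a large facility takes over, earlier charges are dropped with the
    temporary facilities and the sum of all values pays afresh. *)
Lemma pd_processP a U tmp X a' new X' :
  pd_process E st r a U tmp X a' new X' ->
  partial_service a U tmp X -> small_openings a U tmp ->
  partial_service a' set0 new X' /\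
  (small_openings a' set0 new \/ large_opening a' new).
Proof.
elim=> {a U tmp X a' new X'}.
- by move=> a tmp X ps so; split=> //; left.
- move=> a U tmp X a' new X' t t0 ct _ IH [Ur ca a0 oX cX dX] [s [ts us sP]].
  apply: IH.
    split => //.
      move=> e; rewrite ffunE; case: ifP => // _.
      by rewrite addr_ge0.
    apply: le_trans dX _; apply: ler_sum => e; rewrite inE => /andP[eU _].
    by rewrite raise_notin.
  exists s; split => // p ps; have [pU dp fp] := sP p ps; split => //;
  by rewrite raise_notin //; move: pU; rewrite inE => /andP[].
- move=> a U tmp X a' new X' e x eU te xF dx _ IH ps so; apply: IH.
    move: xF; rewrite mem_filter => /andP[ex xo].
    apply: partial_service_setD1 => //; first exact: tight_con1 te dx.
    by rewrite mem_cat xo.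
  case: so => s [-> us sP]; exists s; split => // p /sP[pU dp fp]; split => //.
  by move: pU; rewrite !inE => /andP[/negbTE-> ->]; rewrite andbF.
- move=> a U tmp X a' new X' e m eU te _ IH ps so; apply: IH.
    have [dm _] := tight_con3 eU te.
    apply: partial_service_setD1 => //.
    + by rewrite inE.
    + by rewrite mem_cat mem_rcons mem_head orbT.
    + case: ps => Ur ca a0 oX cX dX; split => // x /oX.
      by rewrite !mem_cat mem_rcons inE => /orP[->|->]; rewrite ?orbT.
  have er : e \in r.2 by case: ps => /subsetP/(_ e eU).
  case: so => s [-> us sP]; exists (rcons s (e, m)); split.
  + by rewrite map_rcons.
  + rewrite /unzip1 map_rcons rcons_uniq us andbT.
    apply/mapP => -[p /sP[pU _ _]] /= ep.
    by move: pU; rewrite -ep !inE eU.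
  move=> p; rewrite mem_rcons inE => /predU1P[->|/sP[pU dp fp]].
    have [dm fm] := tight_con3 eU te; split => //.
    by rewrite !inE eqxx er.
  split=> //.
  by move: pU; rewrite !inE => /andP[/negbTE-> ->]; rewrite andbF.
- move=> a U tmp X x te xF dx [Ur ca a0 oX cX dX] so.
  move: xF; rewrite mem_filter => /andP[/eqP xT xo].
  (* Connecting to an existing large facility opens nothing: this is the case of an empty list of
     small openings. *)
  split; last by left; exists [::].
  split => //.
  + exact: sub0set.
  + by move=> y; rewrite inE => /eqP->; rewrite cats0.
  + by rewrite big_set1 xT subsetT.
  + by rewrite big_set1 setD0; apply: tight_con2 te dx.
- move=> a U tmp X m te [Ur ca a0 oX cX dX] so.
  have [dm fm] := tight_con4 Ur te.
  split; last by right; exists m.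
  split => //.
  + exact: sub0set.
  + by move=> y; rewrite inE => /eqP->; rewrite mem_cat mem_head orbT.
  + by rewrite big_set1 subsetT.
  + by rewrite big_set1 setD0.
Qed.

End Request.

(** * The process can always be continued to its end *)

Section Progress.
Variables (st : pd_state R M S) (r : request M S).

Definition max_raise (x k : R) (D : \bar R) : \bar R :=
  if D is D'%:E then ((D' - x) / k)%:E else D.

Lemma max_raiseP (x k t : R) D : 0 < k ->
  ((x + k * t)%:E <= D)%E = (t%:E <= max_raise x k D)%E.
Proof.
move=> k0; case: D => [D| |] /=.
  by rewrite !lee_fin ler_pdivlMr // lerBrDl mulrC.
  by rewrite !leey.
by rewrite !leeNy_eq.
Qed.

(** One finite index type for all four kinds of constraints lets the first one to stop be chosen by
    a minimum. Constraints of type (1) and (3) are void for served commodities, whose values no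
    longer move. *)
Definition stopping (U : {set S}) (i : S * option M + option M)
    (a : {ffun S -> R}) : Prop :=
  match i with
  | inl (e, None) => e \in U -> con1 E st r e a
  | inl (e, Some m) => e \in U -> con3 E st r e m a
  | inr None => con2 E st r a
  | inr (Some m) => con4 E st r m a
  end.

Definition stopping_time (U : {set S}) (a : {ffun S -> R})
    (i : S * option M + option M) : \bar R :=
  match i with
  | inl (e, None) =>
      if e \in U then max_raise (a e) 1 (dist_to E (Fe st e) r.1) else +oo%E
  | inl (e, Some m) =>
      if e \in U
      then max_raise (a e - d m r.1) 1 (f m [set e] - small_bids st e m)%:E
      else +oo%E
  | inr None =>
      max_raise (\sum_(e in r.2) a e) #|U|%:R (dist_to E (Fhat st) r.1)
  | inr (Some m) =>
      max_raise (\sum_(e in r.2) a e - d m r.1) #|U|%:R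
        (f m [set: S] - large_bids st m)%:E
  end.

Lemma stopping_timeP (U : {set S}) a i t :
  constraints E st r a -> U \subset r.2 -> U != set0 ->
  stopping U i (raise U t a) <-> (t%:E <= stopping_time U a i)%E.
Proof.
case=> _ _ c3 c4 Ur U0.
have k0 : 0 < #|U|%:R :> R by rewrite ltr0n card_gt0.
case: i => [[e [m|]]|[m|]]; rewrite /stopping /stopping_time.
- case: ifP => eU; last by rewrite leey.
  rewrite -max_raiseP // mul1r lee_fin /con3 raise_in // -addrAC.
  have er : e \in r.2 by apply: (subsetP Ur).
  have s0 : 0 <= f m [set e] - small_bids st e m.
    rewrite subr_ge0; apply: le_trans (c3 e m er).
    by rewrite lerDr pos_ge0.
  rewrite -/(small_bids st e m) -lerBrDr pos_le s0 andbT.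
  by split=> [/(_ isT)|].
- case: ifP => eU; last by rewrite leey.
  rewrite -max_raiseP // mul1r /con1 raise_in //.
  by split=> [/(_ isT)|].
- rewrite -max_raiseP // lee_fin /con4 sum_raise // -addrAC.
  have s0 : 0 <= f m [set: S] - large_bids st m.
    rewrite subr_ge0; apply: le_trans (c4 m).
    by rewrite lerDr pos_ge0.
  by rewrite -/(large_bids st m) -lerBrDr pos_le s0 andbT.
- by rewrite -max_raiseP // /con2 sum_raise.
Qed.

(** Raise by the least stopping time: all constraints still hold, and a minimizing one forbids any
    further increase. *)
Lemma raise_until_tight (U : {set S}) a :
  constraints E st r a -> U \subset r.2 -> U != set0 ->
  exists t i, [/\ 0 <= t, constraints E st r (raise U t a),
    tight U (stopping U i) (raise U t a) &
    if i is inl (e, _) then e \in U else true].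
Proof.
move=> ca Ur U0; have stP := stopping_timeP _ _ ca Ur U0.
have [c1 c2 c3 c4] := ca.
case: (@Order.TotalTheory.arg_minP _ _ (S * option M + option M)%type
  (inr (Some r.1)) xpredT (stopping_time U a) isT) => i _ imin.
have i0 : (0 <= stopping_time U a i)%E.
  apply/stP; rewrite raise0; case: {imin} i => [[e [m|]]|[m|]] //=.
  - by move=> eU; apply: c3; apply: (subsetP Ur).
  - by move=> eU; apply: c1; apply: (subsetP Ur).
(* The minimum is finite because constraint (4) at the point [r.1] has a finite stopping time. *)
have [t tE] : exists t, stopping_time U a i = t%:E.
  have := imin (inr (Some r.1)) isT; rewrite {2}/stopping_time /=.
  by case: (stopping_time U a i) i0 => [t _ _| |] //; exists t.
have t0 : 0 <= t by rewrite -lee_fin -tE.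
have tP j : stopping U j (raise U t a) by apply/stP; rewrite -tE imin.
exists t, i; split => //.
- split=> [e er|||m].
  + have [eU|eU] := boolP (e \in U); first exact: (tP (inl (e, None))).
    by rewrite /con1 raise_notin //; apply: c1.
  + exact: (tP (inr None)).
  + move=> e m er.
    have [eU|eU] := boolP (e \in U); first exact: (tP (inl (e, Some m))).
    by rewrite /con3 raise_notin //; apply: c3.
  + exact: (tP (inr (Some m))).
- split => // u u0; rewrite raise_raise => /stP.
  by rewrite tE lee_fin gerDl leNgt u0.
(* An index with a served commodity has stopping time [+oo], so it cannot be the minimizer. *)
case: i tE {i0 imin} => [[e o]|//] /=.
by case: o => [m|]; case: ifP.
Qed.

Lemma dist_to_attained (G : seq (facility M S)) p x : dist_to E G p = x%:E ->
  exists2 g, g \in G & (d g.1 p)%:E = dist_to E G p.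
Proof.
elim: G x => [|g G IH] x; rewrite /dist_to ?big_nil // big_cons.
rewrite -/(dist_to E G p) minEle; case: ifP => [gG _|_ Gx].
  by exists g; rewrite ?mem_head.
by have [h hG <-] := IH _ Gx; exists h; rewrite // in_cons hG orbT.
Qed.

(** An infinite distance never stops a raise, so tightness forces a closest facility to exist. *)
Lemma tight_dist_to (U : {set S}) (F : {ffun S -> R} -> R) a
    (G : seq (facility M S)) p :
  tight U (fun b => ((F b)%:E <= dist_to E G p)%E) a ->
  exists2 g, g \in G & (d g.1 p)%:E = dist_to E G p.
Proof.
case=> Fa /(_ 1 ltr01) H; case D : (dist_to E G p) => [x| |].
- by rewrite -D; apply: dist_to_attained D.
- by case: H; rewrite D leey.
- by rewrite D leeNy_eq in Fa.
Qed.

(** Induction on the number of unserved commodities: after a raise, the tight constraint either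
    serves one of them or ends the process. *)
Lemma pd_process_total (U : {set S}) a tmp X :
  constraints E st r a -> U \subset r.2 ->
  exists a' new X', pd_process E st r a U tmp X a' new X'.
Proof.
move: {2}#|U| (erefl #|U|) => n; elim: n U a tmp X =>
  [|n IH] U a tmp X Un ca Ur.
  have -> : U = set0 by apply/eqP; rewrite -cards_eq0 Un.
  by exists a, tmp, X; constructor.
have U0 : U != set0 by rewrite -card_gt0 Un.
have [t [i [t0 ct ti iU]]] := raise_until_tight ca Ur U0.
suff [a' [new [X' P]]] : exists a' new X',
    pd_process E st r (raise U t a) U tmp X a' new X'.
  by exists a', new, X'; apply: PdRaise P.
move: (raise U t a) ct ti => {ca t t0}b cb.
have D1 e : e \in U -> #|U :\ e| = n /\ U :\ e \subset r.2.
  move=> eU; split; last exact: subset_trans (subsetDl _ _) Ur.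
  by move: Un; rewrite (cardsD1 e) eU => -[].
case: i iU => [[e [m|]]|[m|]] /= iU ti.
- have [cardU subU] := D1 e iU.
  have tb : tight U (con3 E st r e m) b.
    by case: ti => P H; split=> [|u u0 Q]; [apply: P | apply: (H u u0)].
  have [a' [new [X' P]]] := IH _ b (rcons tmp (m, [set e]))
    ((m, [set e]) |: X) cardU cb subU.
  by exists a', new, X'; apply: PdTight3 P.
- have [cardU subU] := D1 e iU.
  have tb : tight U (con1 E st r e) b.
    by case: ti => P H; split=> [|u u0 Q]; [apply: P | apply: (H u u0)].
  have [x xF dx] := tight_dist_to (F := fun c => c e) tb.
  have [a' [new [X' P]]] := IH _ b tmp (x |: X) cardU cb subU.
  by exists a', new, X'; apply: PdTight1 P.
- by exists b, [:: (m, [set: S])], [set (m, [set: S])]; apply: PdTight4 ti.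
- have [x xF dx] := tight_dist_to (F := fun c => \sum_(e in r.2) c e) ti.
  by exists b, [::], [set x]; apply: PdTight2 ti xF dx.
Qed.

End Progress.

End Instance.

(** * Invariants of a run *)

Section Reachable.
Variables (R : realType) (M S : finType) (E : omflp R M S).

Local Notation d := (dist E).
Local Notation f := (cost E).

Implicit Types (st : pd_state R M S) (r : request M S) (a : {ffun S -> R}).
Implicit Types (new : seq (facility M S)) (X : {set facility M S}).

Definition serve (st : pd_state R M S) (r : request M S) (a : {ffun S -> R})
    (new : seq (facility M S)) (X : {set facility M S}) : pd_state R M S :=
  PdState (pd_open st ++ new) (rcons (pd_past st) (ServedRequest r a X)).

(** This is what makes the all-zero values satisfy (3) and (4) when the next request arrives. *)
Definition bids_bounded (st : pd_state R M S) : Prop :=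
  (forall e m, small_bids E st e m <= f m [set e]) /\
  (forall m, large_bids E st m <= f m [set: S]).

Lemma constraints0 st (r : request M S) :
  bids_bounded st -> constraints E st r [ffun=> 0].
Proof.
case=> b3 b4; have s0 : \sum_(e in r.2) ([ffun=> 0] : {ffun S -> R}) e = 0.
  by apply: big1 => e _; rewrite ffunE.
have pos0 m : pos (0 - d m r.1) = 0.
  by apply/eqP; rewrite eq_le pos_ge0 pos_le lexx andbT sub0r oppr_le0 dist_ge0.
split=> [e er||e m er|m].
- by rewrite /con1 ffunE le_dist_to; apply/allP => g _; apply: dist_ge0.
- by rewrite /con2 s0 le_dist_to; apply/allP => g _; apply: dist_ge0.
- by rewrite /con3 ffunE pos0 add0r; apply: b3.
- by rewrite /con4 s0 pos0 add0r; apply: b4.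
Qed.

Lemma pd_serve_total st (r : request M S) :
  bids_bounded st -> exists st', pd_serve E st r st'.
Proof.
move=> /constraints0-/(_ r) c0.
have [a [new [X P]]] := pd_process_total [::] set0 c0 (subxx _).
by exists (serve st r a new X), a, new, X.
Qed.

Lemma pd_serveP st (r : request M S) st' :
  bids_bounded st -> pd_serve E st r st' ->
  exists a new X, [/\ st' = serve st r a new X,
    partial_service E st r a set0 new X &
    small_openings E st r a set0 new \/ large_opening E st r a new].
Proof.
move=> /constraints0-/(_ r) c0 [a [new [X [P ->]]]].
exists a, new, X; have [||ps so] := pd_processP P; last by split.
  split => //.
  - by move=> e; rewrite ffunE.
  - by move=> x; rewrite inE.
  - by rewrite setDv sub0set.
  - by rewrite big_set0 setDv big_set0.
by exists [::].
Qed.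

Lemma Fe_serve st r a new X e : {subset Fe st e <= Fe (serve st r a new X) e}.
Proof. by move=> x; rewrite !mem_filter mem_cat => /andP[-> ->]. Qed.

Lemma Fhat_serve st r a new X : {subset Fhat st <= Fhat (serve st r a new X)}.
Proof. by move=> x; rewrite !mem_filter mem_cat => /andP[-> ->]. Qed.

(** New facilities only lower the capped values of earlier requests, and the new request bids at
    most its uncapped value, so the final constraints (3) and (4) suffice. *)
Lemma bids_bounded_serve st r a new X :
  bids_bounded st -> constraints E st r a ->
  bids_bounded (serve st r a new X).
Proof.
move=> [b3 b4] [_ _ c3 c4]; split=> [e m|m].
- have le : \sum_(j <- pd_past st | e \in (req j).2)
      pos (cap E (dual j e) (Fe (serve st r a new X) e) (req j).1
           - d m (req j).1) <= small_bids E st e m.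
    apply: ler_sum => j _; apply: ler_pos; rewrite lerD2r.
    by apply: cap_subset; apply: Fe_serve.
  rewrite /small_bids /= sum_rcons_cond /=.
  case: ifP => er; last by rewrite addr0 (le_trans le).
  apply: le_trans (c3 e m er); rewrite addrC lerD //.
  by apply: ler_pos; rewrite lerD2r cap_le.
- rewrite /large_bids /= -cats1 big_cat big_seq1 /=.
  apply: le_trans (c4 m); rewrite addrC lerD //.
    by apply: ler_pos; rewrite lerD2r cap_le.
  apply: ler_sum => j _; apply: ler_pos; rewrite lerD2r.
  by apply: cap_subset; apply: Fhat_serve.
Qed.

(** For any [g] in [G], [w x] is at most the distance from [g] to [x], hence at most the distance
    from [g] to [j] plus those from [j] and [x] to [m]. This bounds the cap of [j] from below
    without mentioning [G]. The predicate [P] covers both small and large facilities. *)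
Lemma history_head_cap (w : served_request R M S -> R) (G : seq (facility M S))
    (m : M) (c : R) P x (past : seq (served_request R M S)) :
  ((w x)%:E <= dist_to E G (req x).1)%E ->
  pos (w x - d m (req x).1) +
    \sum_(j <- past | P j) pos (cap E (w j) G (req j).1 - d m (req j).1) <= c ->
  history_head w (fun j => d m (req j).1) c x (rev [seq j <- past | P j]).
Proof.
rewrite le_dist_to => /allP wG; apply: le_trans.
rewrite lerD2l big_rev big_filter; apply: ler_sum => j _.
apply: ler_pos; rewrite lerD2r le_cap ge_min lexx /=; apply/allP => g gG.
rewrite ge_min; apply/orP; right.
have := wG g gG.
have := dist_triangle E g.1 (req j).1 (req x).1.
have := dist_triangle E (req j).1 m (req x).1.
by rewrite (dist_sym E (req j).1 m); lra.
Qed.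

Definition small_history (st : pd_state R M S) : Prop :=
  forall e m, history (fun j => dual j e) (fun j => d m (req j).1) (f m [set e])
    (rev [seq j <- pd_past st | e \in (req j).2]).

Definition large_history (st : pd_state R M S) : Prop :=
  forall m, history (fun j => \sum_(e in (req j).2) dual j e)
    (fun j => d m (req j).1) (f m [set: S]) (rev (pd_past st)).

Lemma small_history_serve st r a new X :
  constraints E st r a -> small_history st ->
  small_history (serve st r a new X).
Proof.
move=> [c1 _ c3 _] hs e m; rewrite /= filter_rcons /=.
case: ifP => er //; rewrite rev_rcons; split => //.
exact: (@history_head_cap (fun j => dual j e) (Fe st e) m (f m [set e])
  (fun j => e \in (req j).2) (ServedRequest r a X) (pd_past st)
  (c1 e er) (c3 e m er)).
Qed.

Lemma large_history_serve st r a new X :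
  constraints E st r a -> large_history st ->
  large_history (serve st r a new X).
Proof.
move=> [_ c2 _ c4] hs m; rewrite /= rev_rcons; split => //.
have := @history_head_cap (fun j => \sum_(e in (req j).2) dual j e) (Fhat st) m
  (f m [set: S]) xpredT (ServedRequest r a X) (pd_past st) c2 (c4 m).
by rewrite filter_predT.
Qed.

(* The part of the values that is still available to finance small (resp.
   large) facilities. *)
Definition small_potential (st : pd_state R M S) (e : S) : R :=
  \sum_(j <- pd_past st | e \in (req j).2)
     cap E (dual j e) (Fe st e) (req j).1.

Definition large_potential (st : pd_state R M S) : R :=
  \sum_(j <- pd_past st)
     cap E (\sum_(e in (req j).2) dual j e) (Fhat st) (req j).1.

(** Opening [g] lowers a capped value by at least the bid it made towards [g]. *)
Lemma cap_open (x : R) (G G' : seq (facility M S)) p (g : facility M S) :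
  {subset G <= G'} -> g \in G' ->
  cap E x G' p <= cap E x G p - pos (cap E x G p - d g.1 p).
Proof.
move=> GG' gG'; rewrite lerBrDr -lerBrDl pos_le subr_ge0 cap_subset // andbT.
by have := cap_le_dist E x p gG'; lra.
Qed.

Definition nonneg_duals (st : pd_state R M S) : bool :=
  all (fun j => [forall e, 0 <= dual j e]) (pd_past st).

Lemma small_potential_serve st r a new X e :
  small_potential (serve st r a new X) e <=
  small_potential st e + (if e \in r.2 then a e else 0).
Proof.
rewrite /small_potential /= sum_rcons_cond /= lerD //.
  by apply: ler_sum => j _; apply: cap_subset; apply: Fe_serve.
by case: ifP => // _; apply: cap_le.
Qed.

(** The earlier requests lose their bids, and the new one keeps at most its distance to [m] out of
    [a e]; together these losses cover the cost. *)
Lemma small_potential_open st r a new X e m :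
  (m, [set e]) \in new -> e \in r.2 ->
  f m [set e] <= a e - d m r.1 + small_bids E st e m ->
  f m [set e] + small_potential (serve st r a new X) e <=
  small_potential st e + a e.
Proof.
move=> mnew er fm.
have mF : (m, [set e]) \in Fe (serve st r a new X) e.
  by rewrite mem_filter mem_cat mnew orbT /= inE eqxx.
rewrite /small_potential /= sum_rcons_cond /= er.
have le1 := cap_le_dist E (a e) r.1 mF.
have le2 : \sum_(j <- pd_past st | e \in (req j).2)
    cap E (dual j e) (Fe (serve st r a new X) e) (req j).1 <=
    small_potential st e - small_bids E st e m.
  rewrite /small_potential /small_bids -sumrB; apply: ler_sum => j _.
  by apply: (cap_open _ _ _ mF); apply: Fe_serve.
rewrite /small_potential /= in le1 le2 *; lra.
Qed.

Lemma large_potential_serve st r a new X :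
  large_potential (serve st r a new X) <=
  large_potential st + \sum_(e in r.2) a e.
Proof.
rewrite /large_potential /= -cats1 big_cat big_seq1 /= lerD ?cap_le //.
by apply: ler_sum => j _; apply: cap_subset; apply: Fhat_serve.
Qed.

Lemma large_potential_open st r a new X m :
  (m, [set: S]) \in new ->
  f m [set: S] <= \sum_(e in r.2) a e - d m r.1 + large_bids E st m ->
  f m [set: S] + large_potential (serve st r a new X) <=
  large_potential st + \sum_(e in r.2) a e.
Proof.
move=> mnew fm.
have mF : (m, [set: S]) \in Fhat (serve st r a new X).
  by rewrite mem_filter mem_cat mnew orbT /= eqxx.
rewrite /large_potential /= -cats1 big_cat big_seq1 /=.
have le1 := cap_le_dist E (\sum_(e in r.2) a e) r.1 mF.
have le2 : \sum_(j <- pd_past st) cap E (\sum_(e in (req j).2) dual j e)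
    (Fhat (serve st r a new X)) (req j).1 <=
    large_potential st - large_bids E st m.
  rewrite /large_potential /large_bids -sumrB; apply: ler_sum => j _.
  by apply: (cap_open _ _ _ mF); apply: Fhat_serve.
rewrite /large_potential /= in le1 le2 *; lra.
Qed.

Definition potential (st : pd_state R M S) : R :=
  \sum_e small_potential st e + large_potential st.

Lemma potential_ge0 st : nonneg_duals st -> 0 <= potential st.
Proof.
move=> /all_filterP nn; rewrite addr_ge0 //.
  apply: sumr_ge0 => e _; rewrite /small_potential -nn big_filter_cond.
  by apply: sumr_ge0 => j /andP[/forallP j0 _]; apply: cap_ge0.
rewrite /large_potential -nn big_filter.
apply: sumr_ge0 => j /forallP j0; apply: cap_ge0.
by apply: sumr_ge0.
Qed.

(** Each new value enters one small potential and the large potential, whence the factor 2. *)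
Lemma potential_serve st r a new X :
  (forall e, 0 <= a e) ->
  small_openings E st r a set0 new \/ large_opening E st r a new ->
  \sum_(x <- new) f x.1 x.2 + potential (serve st r a new X) <=
  potential st + 2 * \sum_(e in r.2) a e.
Proof.
move=> a0 new_openings; set st' := serve _ _ _ _ _.
(* The amount of small potential for [e] that is consumed in this step. Distinct openings are
   charged to distinct commodities; a large opening only needs these amounts to be nonnegative. *)
pose gain e := small_potential st e + (if e \in r.2 then a e else 0)
  - small_potential st' e.
have gain0 e : 0 <= gain e by rewrite subr_ge0 small_potential_serve.
have sum_gain : \sum_e gain e = \sum_e small_potential st e +
    \sum_(e in r.2) a e - \sum_e small_potential st' e.
  by rewrite sumrB big_split /= -big_mkcond.
have largele := large_potential_serve st r a new X.
rewrite -/st' in largele.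
case: new_openings => [[s [newE us sP]]|[m [newE dm fm]]].
- have : \sum_(x <- new) f x.1 x.2 <= \sum_e gain e.
    rewrite newE big_map.
    apply: (@le_trans _ _ (\sum_(p <- s) gain p.1)).
      rewrite big_seq [leRHS]big_seq; apply: ler_sum => p ps.
      have [pr dp fp] := sP p ps; rewrite setD0 in pr.
      rewrite /gain pr lerBrDr; apply: small_potential_open => //.
      by rewrite newE; apply/mapP; exists p.
    rewrite -(big_map fst xpredT gain) /= big_uniq //=.
    by rewrite [leRHS](bigID (mem (unzip1 s))) /= lerDl sumr_ge0.
  rewrite sum_gain /potential; lra.
- have := @large_potential_open st r a new X m.
  rewrite newE mem_head -newE -/st'.
  move=> /(_ isT fm) fle.
  have : 0 <= \sum_e gain e by apply: sumr_ge0.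
  rewrite {1}newE big_seq1 sum_gain /potential /=; lra.
Qed.

(** * States reachable under any resolution of ties *)

Inductive reachable : pd_state R M S -> Prop :=
| ReachableNil : reachable (PdState [::] [::])
| ReachableServe st r st' :
    reachable st -> pd_serve E st r st' -> reachable st'.

Lemma reachable_bids st : reachable st -> bids_bounded st.
Proof.
elim=> {st}[|st r st' _ bb].
  by split=> [e m|m]; rewrite /small_bids /large_bids big_nil cost_ge0.
case/(pd_serveP bb) => a [new [X [-> [_ ca _ _ _ _] _]]].
exact: bids_bounded_serve.
Qed.

Lemma reachable_ind_serve (P : pd_state R M S -> Prop) :
  P (PdState [::] [::]) ->
  (forall st r a new X, reachable st -> P st ->
     partial_service E st r a set0 new X ->
     small_openings E st r a set0 new \/ large_opening E st r a new ->
     P (serve st r a new X)) ->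
  forall st, reachable st -> P st.
Proof.
move=> P0 PS st; elim=> {st}[//|st r st' rst Pst].
case/(pd_serveP (reachable_bids rst)) => a [new [X [-> ps so]]].
exact: PS.
Qed.

Lemma reachable_small_history st : reachable st -> small_history st.
Proof.
elim/reachable_ind_serve: st / => [//|st r a new X _ hs [_ ca _ _ _ _] _].
exact: small_history_serve.
Qed.

Lemma reachable_large_history st : reachable st -> large_history st.
Proof.
elim/reachable_ind_serve: st / => [//|st r a new X _ hs [_ ca _ _ _ _] _].
exact: large_history_serve.
Qed.

Lemma reachable_nonneg st : reachable st -> nonneg_duals st.
Proof.
elim/reachable_ind_serve: st / => [//|st r a new X _ nn [_ _ a0 _ _ _] _].
by rewrite /nonneg_duals /= all_rcons; apply/andP; split=> //; apply/forallP.
Qed.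

Lemma reachable_feasible st :
  reachable st -> feasible [seq req j | j <- pd_past st] (pd_solution st).
Proof.
elim/reachable_ind_serve: st / => [//|st r a new X _ [sz fe] [_ _ _ oX cX _] _].
split; first by rewrite !size_map.
rewrite /= !map_rcons zip_rcons ?size_map // => p.
rewrite mem_rcons inE => /predU1P[->|/fe[po pc]].
  by rewrite setD0 in cX; split.
by split=> // x /po xo; rewrite mem_cat xo.
Qed.

Lemma total_cost_pd_solution st :
  total_cost E [seq req j | j <- pd_past st] (pd_solution st) =
  \sum_(x <- pd_open st) f x.1 x.2 +
  \sum_(j <- pd_past st) \sum_(x in facs j) d x.1 (req j).1.
Proof. by rewrite /total_cost /= zip_map2 big_map. Qed.

(** The sum of the values pays once for the assignments and twice for the two potentials, out of
    which the facilities are built. *)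
Lemma reachable_cost st : reachable st ->
  total_cost E [seq req j | j <- pd_past st] (pd_solution st) + potential st
  <= 3 * \sum_(j <- pd_past st) \sum_(e in (req j).2) dual j e.
Proof.
elim/reachable_ind_serve: st / => [|st r a new X _];
  rewrite total_cost_pd_solution.
  rewrite /potential /small_potential /large_potential /= !big_nil.
  by rewrite big1 ?addr0 ?mulr0 // => e _; rewrite big_nil.
move=> IH [_ _ a0 _ _ dX] so; rewrite total_cost_pd_solution.
rewrite setD0 in dX; have := potential_serve X a0 so.
rewrite /= big_cat !sum_rcons_cond /=.
move: dX IH; lra.
Qed.

End Reachable.

(** * Comparison with an arbitrary solution *)

Section LowerBound.
Variables (R : realType) (M S : finType) (E : omflp R M S).

Local Notation d := (dist E).
Local Notation f := (cost E).

(** The entries of [z] are past requests with extra data, such as their assignment in the solution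
    to compare with; [P] will select those assigned to one given facility. *)
Variables (st : pd_state R M S) (Z : Type) (g : Z -> served_request R M S).
Variables (z : seq Z) (P : pred Z).
Hypotheses (rst : reachable E st) (gz : map g z = pd_past st).

Local Notation H := (series (@harmonic R) (size (pd_past st))).
Local Notation demand q := (req (g q)).2.

(** The selected requests demanding [e] form a sublist of a history, so [history_sum] applies. Its
    harmonic number is at most that of all requests, and the selected requests not demanding [e]
    only add distances. *)
Lemma small_dual_le (m : M) (e : S) :
  \sum_(q <- z | P q && (e \in demand q)) dual (g q) e <=
  H * (2 * f m [set e] + 6 * \sum_(q <- z | P q) d m (req (g q)).1).
Proof.
have := reachable_small_history rst e m.
rewrite -gz filter_map -map_rev history_map => /(@history_filter _ _ _ _ _ P).
move=> /history_sum-/(_ (fun _ => dist_ge0 _ _ _) (cost_ge0 _ _ _)).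
rewrite !big_filter !big_rev !big_filter_cond => le.
apply: le_trans (le_trans le _); first by under eq_bigl do rewrite andbC.
have D0 : 0 <= \sum_(q <- z | P q) d m (req (g q)).1.
  by apply: sumr_ge0 => q _; apply: dist_ge0.
have f0 := cost_ge0 E m [set e].
apply: ler_pM; rewrite ?series_harmonic_ge0 ?addr_ge0 ?mulr_ge0 //.
- by apply: sumr_ge0 => q _; apply: dist_ge0.
- apply: series_harmonic_le; rewrite size_filter.
  rewrite (leq_trans (count_size _ _)) // size_rev size_filter size_map.
  exact: count_size.
rewrite lerD2l ler_wpM2l // [leRHS](bigID (fun q => e \in demand q)) /=.
under eq_bigl do rewrite andbC.
by rewrite lerDl; apply: sumr_ge0 => q _; apply: dist_ge0.
Qed.

Lemma large_dual_le (m : M) :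
  \sum_(q <- z | P q) \sum_(e in demand q) dual (g q) e <=
  H * (2 * f m [set: S] + 6 * \sum_(q <- z | P q) d m (req (g q)).1).
Proof.
have := reachable_large_history rst m.
rewrite -gz -map_rev history_map => /(@history_filter _ _ _ _ _ P).
move=> /history_sum-/(_ (fun _ => dist_ge0 _ _ _) (cost_ge0 _ _ _)).
rewrite !big_filter !big_rev => le; apply: le_trans le _.
rewrite ler_wpM2r //.
  rewrite addr_ge0 // mulr_ge0 ?cost_ge0 //.
  by apply: sumr_ge0 => q _; apply: dist_ge0.
apply: series_harmonic_le; rewrite size_filter (leq_trans (count_size _ _)) //.
by rewrite size_rev size_map.
Qed.

(** By [cost_ratio] the loss is at most [|S| / |sigma|], which is below [sqrt |S|] for such a
    [sigma]. *)
Lemma cost_setT_le (m : M) (sigma : {set S}) :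
  Num.sqrt #|S|%:R < #|sigma|%:R :> R ->
  f m [set: S] <= Num.sqrt #|S|%:R * f m sigma.
Proof.
move=> lt; have s0 : 0 < #|sigma|%:R :> R.
  by apply: le_lt_trans lt; apply: sqrtr_ge0.
have sn0 : sigma != set0 by rewrite -card_gt0 -(ltr0n R).
have S0 : 0 < #|S|%:R :> R.
  by apply: lt_le_trans s0 _; rewrite ler_nat max_card.
have := cost_ratio E m sn0; rewrite ler_pdivrMr // => /le_trans; apply.
have f0 := cost_ge0 E m sigma.
rewrite mulrAC ler_pdivrMr // mulrC -[X in X * _ <= _]sqr_sqrtr ?(ltW S0) //.
rewrite expr2 -!mulrA ler_wpM2l ?sqrtr_ge0 // mulrC ler_wpM2l //.
exact: ltW.
Qed.

Lemma dual_le_facility (m : M) (sigma : {set S}) :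
  \sum_(q <- z | P q) \sum_(e in sigma | e \in demand q) dual (g q) e <=
  Num.sqrt #|S|%:R * H *
    (2 * f m sigma + 6 * \sum_(q <- z | P q) d m (req (g q)).1).
Proof.
set D := \sum_(q <- z | P q) d _ _.
have D0 : 0 <= D by apply: sumr_ge0 => q _; apply: dist_ge0.
have H0 : 0 <= H := series_harmonic_ge0 _ _.
have f0 := cost_ge0 E m sigma.
have [le|lt] := leP (#|sigma|%:R : R) (Num.sqrt #|S|%:R).
  rewrite (exchange_big_dep (mem sigma)) /=; last by move=> q e _ /andP[].
  apply: (@le_trans _ _ (\sum_(e in sigma) H * (2 * f m sigma + 6 * D))).
    apply: ler_sum => e es.
    under eq_bigl do rewrite es /=.
    apply: le_trans (small_dual_le m e) _.
    by rewrite ler_wpM2l // lerD2r ler_wpM2l // cost_single.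
  rewrite sumr_const -[leLHS]mulr_natl -[leRHS]mulrA ler_wpM2r //.
  by rewrite mulr_ge0 // addr_ge0 // mulr_ge0.
apply: (@le_trans _ _ (\sum_(q <- z | P q) \sum_(e in demand q) dual (g q) e)).
  have nn := reachable_nonneg rst; rewrite /nonneg_duals -gz all_map in nn.
  rewrite -(all_filterP nn) !big_filter_cond.
  apply: ler_sum => q /andP[/forallP q0 _].
  rewrite [leRHS](bigID (mem sigma)) /=; under eq_bigl do rewrite andbC.
  by rewrite lerDl sumr_ge0.
apply: le_trans (large_dual_le m) _; rewrite -/D.
rewrite mulrAC [leRHS]mulrC ler_wpM2l //.
have := cost_setT_le m lt.
(* In the large case the distances are counted once only; [S] is nonempty here, so its root is at
   least 1. *)
have : D <= Num.sqrt #|S|%:R * D.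
  have S1 : (1 : R) <= #|S|%:R.
    rewrite ler1n; case: posnP => // S0; move: lt.
    by rewrite S0 sqrtr0 ltr0n ltnNge -S0 max_card.
  by rewrite ler_peMl // -[leLHS]sqrtr1 ler_wsqrtr.
rewrite mulrDr !mulrA ![_ * 2]mulrC ![_ * 6]mulrC -!mulrA; lra.
Qed.

End LowerBound.

(** Every demanded commodity is offered by a facility assigned to the request, so the values can be
    regrouped by facility, each group being bounded by [dual_le_facility]. The constants 2 and 6 are
    merged into 6. *)
Lemma dual_le_total_cost (R : realType) (M S : finType) (E : omflp R M S)
    (st : pd_state R M S) (sol : solution M S) :
  reachable E st -> feasible [seq req j | j <- pd_past st] sol ->
  \sum_(j <- pd_past st) \sum_(e in (req j).2) dual j e <=
  6 * (Num.sqrt #|S|%:R * series harmonic (size (pd_past st))) *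
    total_cost E [seq req j | j <- pd_past st] sol.
Proof.
move=> rst [sz]; rewrite /total_cost zip_mapl big_map size_map in sz * => fe.
set z := zip (pd_past st) (assigned sol) in fe *.
set K := _ * series _ _.
have K0 : 0 <= K by rewrite mulr_ge0 ?sqrtr_ge0 ?series_harmonic_ge0.
have gz : map fst z = pd_past st by rewrite -/(unzip1 z) unzip1_zip // sz.
(* Feasibility and nonnegativity are gathered in a boolean predicate, so that sums over [z] can be
   restricted to it by filtering. *)
pose good (q : served_request R M S * {set facility M S}) :=
  [&& [forall e, 0 <= dual q.1 e], q.2 \subset opened sol &
      (req q.1).2 \subset \bigcup_(x in q.2) x.2].
have gd : all good z.
  have nn := reachable_nonneg rst; rewrite /nonneg_duals -gz all_map in nn.
  have : all [pred p : request M S * {set facility M S} |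
      (p.2 \subset opened sol) && (p.1.2 \subset \bigcup_(x in p.2) x.2)]
      [seq (req q.1, q.2) | q <- z].
    apply/allP => p /fe[po pc]; rewrite /= pc andbT.
    by apply/subsetP.
  rewrite all_map => cov; move/andP: (conj nn cov); rewrite -all_predI.
  by apply: sub_all => q /andP[q0 /andP[qo qc]]; apply/and3P.
have -> : \sum_(j <- pd_past st) \sum_(e in (req j).2) dual j e =
    \sum_(q <- z) \sum_(e in (req q.1).2) dual q.1 e by rewrite -gz big_map.
apply: (@le_trans _ _ (\sum_(q <- z) \sum_(x in q.2)
    \sum_(e in x.2 | e \in (req q.1).2) dual q.1 e)).
  apply: (ler_sum_all gd) => q /and3P[/forallP q0 _ /subsetP cov].
  rewrite (exchange_big_dep (fun e => e \in (req q.1).2)) /=; last first.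
    by move=> x e _ /andP[].
  apply: ler_sum => e eq; have /bigcupP[x xq ex] := cov e eq.
  rewrite (bigD1 x) /= ?xq ?ex ?eq // lerDl.
  by apply: sumr_ge0.
have swap (F : served_request R M S * {set facility M S} -> facility M S -> R) :
    \sum_(q <- z) \sum_(x in q.2) F q x =
    \sum_x \sum_(q <- z | x \in q.2) F q x.
  by rewrite (exchange_big_dep xpredT).
rewrite !{}swap [leLHS](bigID (mem (opened sol))) /=.
(* No request is assigned to a facility that is not opened, so the other terms vanish. *)
rewrite [X in _ + X]big1 => [|x xo].
  rewrite addr0.
  set D := fun x => \sum_(q <- z | x \in q.2) dist E x.1 (req q.1).1.
  have D0 x : 0 <= D x by apply: sumr_ge0 => q _; apply: dist_ge0.
  apply: (@le_trans _ _
      (\sum_(x in opened sol) 6 * K * (cost E x.1 x.2 + D x))).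
    apply: ler_sum => x _.
    apply: le_trans (dual_le_facility _ rst gz x.1 x.2) _.
    rewrite -/(D x) -/K [6 * K]mulrC -[leRHS]mulrA ler_wpM2l //.
    have := cost_ge0 E x.1 x.2; lra.
  rewrite -mulr_sumr big_split /=.
  apply: ler_wpM2l; [by rewrite mulr_ge0 | apply: lerD].
    by apply: sum_mem_le => x; apply: cost_ge0.
  rewrite [leRHS](bigID (mem (opened sol))) /= lerDl.
  by apply: sumr_ge0 => x _; apply: D0.
rewrite -(all_filterP gd) big_filter_cond big1 // => q.
by case/andP=> /and3P[_ /subsetP so _] /so xs; rewrite xs in xo.
Qed.

(** * Existence, validity and competitiveness of the algorithm *)

Lemma run_reachable (R : realType) (M S : finType) (E : omflp R M S)
    (run : seq (request M S) -> pd_state R M S) :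
  run [::] = PdState [::] [::] ->
  (forall rs r, pd_serve E (run rs) r (run (rcons rs r))) ->
  forall rs, reachable E (run rs) /\ [seq req j | j <- pd_past (run rs)] = rs.
Proof.
move=> run0 runS; elim/last_ind => [|rs r [rr rq]].
  by rewrite run0; split => //; constructor.
split; first exact: ReachableServe rr (runS rs r).
by have [a [new [X [_ ->]]]] := runS rs r; rewrite /= map_rcons rq.
Qed.

Lemma PD_OMFLP_exists (R : realType) :
  exists A : online_algorithm R, is_PD_OMFLP A.
Proof.
(* A successor is chosen classically; the default [st] never occurs at a reachable state, by
   [pd_serve_total]. *)
pose step (M S : finType) (E : omflp R M S) st r : pd_state R M S :=
  if pselect (exists st', pd_serve E st r st') is left H
  then projT1 (cid H) else st.
pose run (M S : finType) (E : omflp R M S) rs :=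
  foldl (step M S E) (PdState [::] [::]) rs.
exists (fun M S E rs => pd_solution (run M S E rs)) => M S E.
exists (run M S E); split => //.
have stepP st r : reachable E st -> pd_serve E st r (step M S E st r).
  move=> rst; rewrite /step; case: pselect => [H|[]].
    exact: projT2 (cid H).
  by apply: pd_serve_total; apply: reachable_bids.
have runP rs : reachable E (run M S E rs).
  elim/last_ind: rs => [|rs r rr]; first exact: ReachableNil.
  by rewrite /run foldl_rcons; apply: ReachableServe rr (stepP _ _ rr).
by move=> rs r; rewrite {2}/run foldl_rcons; apply: stepP; apply: runP.
Qed.

Lemma PD_OMFLP_valid (R : realType) (A : online_algorithm R) :
  is_PD_OMFLP A -> valid_online A.
Proof.
move=> pdA M S E rs; have [run [run0 runS AE]] := pdA M S E.
have [rr rq] := run_reachable run0 runS rs; rewrite !AE.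
split; first by have := reachable_feasible rr; rewrite rq.
move=> r; rewrite AE; have [a [new [X [_ ->]]]] := runS rs r.
split; first exact: prefix_prefix.
by exists X; rewrite /= map_rcons.
Qed.

(** The constant is [18 = 3 * 6]: cost against values, then values against any feasible solution. *)
Lemma PD_OMFLP_competitive (R : realType) (A : online_algorithm R) :
  is_PD_OMFLP A ->
  competitive A (fun s n => 18 * (Num.sqrt s%:R * series harmonic n)).
Proof.
move=> pdA; exists 0 => M S E rs; rewrite addr0.
have [fe _] := PD_OMFLP_valid pdA E rs.
have [run [run0 runS AE]] := pdA M S E; rewrite AE in fe *.
have [rr rq] := run_reachable run0 runS rs.
have szr : size (pd_past (run rs)) = size rs by rewrite -[in RHS]rq size_map.
set K := _ * series _ _.
have K0 : 0 <= K by rewrite mulr_ge0 ?sqrtr_ge0 ?series_harmonic_ge0.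
have le sol : feasible rs sol ->
    total_cost E rs (pd_solution (run rs)) <= 18 * K * total_cost E rs sol.
  move=> fsol; have := @dual_le_total_cost _ _ _ _ _ sol rr.
  rewrite rq szr -/K => /(_ fsol) dle.
  have := reachable_cost rr; rewrite rq => cle.
  have := potential_ge0 E (reachable_nonneg rr).
  lra.
(* Passing to the infimum divides by [18 * K]. If [K = 0], comparing the algorithm with its own
   solution shows that its cost is at most 0. *)
have [K00|Kn0] := eqVneq K 0.
  by have := le _ fe; rewrite K00 mulr0 !mul0r.
have Kp : 0 < 18 * K by rewrite mulr_gt0 // lt_def Kn0.
rewrite mulrC -ler_pdivrMr //; apply: lb_le_inf.
  by exists (total_cost E rs (pd_solution (run rs))), (pd_solution (run rs)).
by move=> _ [sol fsol <-]; rewrite ler_pdivrMr // mulrC le.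
Qed.

Theorem theorem4 (R : realType) :
  (exists A : online_algorithm R, is_PD_OMFLP A) /\
  exists c : nat -> nat -> R,
    (exists C : R, forall s n : nat, (2 <= n)%N ->
       `|c s n| <= C * (Num.sqrt s%:R * ln n%:R)) /\
    forall A : online_algorithm R, is_PD_OMFLP A ->
      valid_online A /\ competitive A c.
Proof.
split; first exact: PD_OMFLP_exists.
exists (fun s n => 18 * (Num.sqrt s%:R * series harmonic n)); split; last first.
  by move=> A pdA; split; [apply: PD_OMFLP_valid | apply: PD_OMFLP_competitive].
exists (18 * (1 + (ln 2)^-1)) => s n n2.
rewrite ger0_norm ?mulr_ge0 ?sqrtr_ge0 ?series_harmonic_ge0 //.
rewrite -mulrA ler_wpM2l // mulrCA ler_wpM2l ?sqrtr_ge0 //.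
exact: series_harmonic_O.
Qed.
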